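(* Let $(\mathcal Q,d)$ be a metric space and let $y,z,q,p\in\mathcal Q$. Assume $$d(y,q)^2-d(y,p)^2-d(z,q)^2+d(z,p)^2\le 2\,d(q,p)\,d(y,z).$$ Let $\tau\colon[0,\infty)\to\mathbb R$ be differentiable, and assume that $\tau$ is nondecreasing, convex and has a concave derivative $\tau'$. Then $$\tau(d(y,q))-\tau(d(y,p))-\tau(d(z,q))+\tau(d(z,p))\le 2\,d(q,p)\,\tau'(d(y,z)).$$
   Context: The derivative at $0$ is the right derivative, which for such $\tau$ equals $\lim_{x\searrow 0}\tau'(x)$. The hypothesis on the squared distances is only required for the specific four points $y,z,q,p$ in the given order. *)

(* Defs.v *)
From mathcomp Require Import all_boot all_order all_algebra.
From mathcomp Require Import all_classical all_reals all_analysis.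
Import Order.TTheory GRing.Theory Num.Theory.
Import numFieldNormedType.Exports.

Set Implicit Arguments.
Unset Strict Implicit.
Unset Printing Implicit Defensive.

Local Open Scope classical_set_scope.
Local Open Scope ring_scope.
Local Open Scope convex_scope.

Definition right_quotient (R : realType) (f : R -> R) (x h : R) : R :=
  h^-1 * (f (h + x) - f x).

(* A function on [0, +oo) is encoded as a total function R -> R; its values on
   negative arguments are never constrained nor used. *)
Definition differentiable_on_halfline (R : realType) (f : R -> R) : Prop :=
  cvg (right_quotient f 0 h @[h --> 0^'+]) /\
  forall x : R, 0 < x -> derivable f x 1.

(* The derivative of f as a function on [0, +oo): one-sided at the endpoint. *)
Definition halfline_derive (R : realType) (f : R -> R) (x : R) : R :=
  if x == 0 then lim (right_quotient f 0 h @[h --> 0^'+]) else derive1 f x.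

(* Same conventions as convex_function. *)
Definition concave_function (R : numFieldType) (E : lmodType R)
    (D : set (convex_lmodType E)) (f : convex_lmodType E -> R^o) : Prop :=
  forall t : {i01 R},
    {in D &, forall x y : convex_lmodType E,
      f x <| t |> f y <= f (x <| t |> y)}.

(* Main.v *)
Require Import Defs.
From mathcomp Require Import all_boot all_order all_algebra.
From mathcomp Require Import all_classical all_reals all_analysis.
From mathcomp Require Import ring lra.
Import Order.TTheory GRing.Theory Num.Theory.
Import numFieldNormedType.Exports.

(** Write [f] for the derivative of [tau], [s] for [d(q,p)], [t] for [d(y,z)],
and [a, c, b, e] for [d(y,q), d(y,p), d(z,q), d(z,p)]. Everything happens on the
real line: the triangle inequality bounds [a - c] and [e - b] by [s] and
[a - b] and [c - e] by [t] in absolute value, and the quantity to bound,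
[(tau a - tau c) + (tau e - tau b)], is a sum of two signed integrals of [f].

The function [f] is nonnegative (as [tau] is nondecreasing) and concave, hence
nondecreasing, subadditive, and such that [f x / x] is nonincreasing. Two bounds
on increments of [tau] follow.

- [antiderivative_increment]: by concavity the mean of [f] over [x, y] is at
  most its value at the midpoint, which is at most [f t] times
  [max 1 ((x + y) / (2 t))]. Multiplied by [y - x], the second term of this
  maximum turns into a difference of squares; this is how the hypothesis on the
  squared distances enters.
- [antiderivative_shift_le]: by subadditivity, two increments of [tau] over
  intervals of the same length [h], shifted from one another by at most [t],
  differ by at most [h * f t].

If both increments are nonpositive there is nothing to do. If both are
nonnegative, apply the first bound to each ([two_increments_le]). If they have
opposite signs ([opposite_increments_le]), say [c <= a] and [e <= b], and
[e, b] is at least as long as [c, a], the second bound suffices. If it is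
shorter, either [e, b] lies inside [c, a], and what remains of [c, a] is
again a pair of intervals to which [two_increments_le] applies, or the right end
of [c, a] is compared with [e, b] by the second bound and the rest of
[c, a] is estimated by the first. *)

Set Implicit Arguments.
Unset Strict Implicit.
Unset Printing Implicit Defensive.

Local Open Scope classical_set_scope.
Local Open Scope ring_scope.

(** * Nonnegative concave functions on a half-line *)

Definition concave_on_halfline (R : realType) (f : R -> R) : Prop :=
  forall x y l : R, 0 <= x -> 0 <= y -> 0 <= l <= 1 ->
    l * f x + (1 - l) * f y <= f (l * x + (1 - l) * y).

(** If [f y < f x] with [x < y], concavity would drive [f] below zero far to the
right. Quantitatively, [y] is a barycenter of [x], with weight [1 - l], and of a
point further right with weight [l], so that [f y >= (1 - l) f x] for every
[l] in (0, 1]. *)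
Lemma concave_ge0_nondecreasing (R : realType) (f : R -> R)
    (f_ge0 : forall x, 0 <= x -> 0 <= f x) (f_concave : concave_on_halfline f)
    (x y : R) : 0 <= x -> x <= y -> f x <= f y.
Proof.
move=> x0 xy; apply/ler_addgt0Pl => eps eps0.
have fx0 := f_ge0 _ x0.
(* This weight makes the loss [l * f x] at most [eps]. *)
pose l := eps / (f x + eps).
have den0 : 0 < f x + eps by lra.
have l0 : 0 < l by rewrite divr_gt0.
have l1 : l <= 1 by rewrite ler_pdivrMr//; lra.
have z0 : 0 <= x + (y - x) / l.
  by rewrite addr_ge0// divr_ge0 ?subr_ge0// ltW.
have l01 : 0 <= 1 - l <= 1 by lra.
have := f_concave x (x + (y - x) / l) (1 - l) x0 z0 l01.
have -> : (1 - l) * x + (1 - (1 - l)) * (x + (y - x) / l) = y.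
  by field; exact: lt0r_neq0.
have fz0 : 0 <= (1 - (1 - l)) * f (x + (y - x) / l).
  by rewrite mulr_ge0 ?f_ge0//; lra.
have lfx : l * f x <= eps.
  by rewrite /l mulrAC ler_pdivrMr// ler_wpM2l//; lra.
lra.
Qed.

(** The ratio [f x / x] is nonincreasing because the graph of [f] lies above its
chord from [0] to [x], and [f 0 >= 0]. *)
Lemma concave_ge0_ratio (R : realType) (f : R -> R)
    (f_ge0 : forall x, 0 <= x -> 0 <= f x) (f_concave : concave_on_halfline f)
    (t x : R) : 0 <= t -> t <= x -> t * f x <= x * f t.
Proof.
move=> t0 tx; have [x0|x0] := eqVneq x 0.
  have -> : t = 0 by lra.
  by rewrite x0.
have xgt0 : 0 < x by rewrite lt0r x0 (le_trans t0 tx).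
have l01 : 0 <= t / x <= 1.
  by rewrite divr_ge0 ?(ltW xgt0)//= ler_pdivrMr// mul1r.
have := f_concave x 0 (t / x) (ltW xgt0) (lexx 0) l01.
rewrite mulr0 addr0 divfK// => H.
have f00 : 0 <= (1 - t / x) * f 0 by rewrite mulr_ge0 ?f_ge0//; lra.
have : t / x * f x <= f t by lra.
by rewrite mulrAC ler_pdivrMr// [f t * x]mulrC.
Qed.

(** Both [f x] and [f y] are at least their proportional shares of [f (x + y)]. *)
Lemma concave_ge0_subadditive (R : realType) (f : R -> R)
    (f_ge0 : forall x, 0 <= x -> 0 <= f x) (f_concave : concave_on_halfline f)
    (x y : R) : 0 <= x -> 0 <= y -> f (x + y) <= f x + f y.
Proof.
move=> x0 y0; have [xy0|xy0] := leP (x + y) 0.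
  have -> : x = 0 by lra.
  by rewrite add0r lerDr f_ge0.
have Hx : x * f (x + y) <= (x + y) * f x by apply: concave_ge0_ratio => //; lra.
have Hy : y * f (x + y) <= (x + y) * f y by apply: concave_ge0_ratio => //; lra.
by rewrite -(ler_pM2l xy0); lra.
Qed.

(** * Increments of an antiderivative *)

Lemma le_of_derive_le0 (R : realType) (phi dphi : R -> R) (h : R) :
  continuous phi -> 0 <= h ->
  (forall x : R, 0 < x -> x < h -> is_derive x 1 phi (dphi x)) ->
  (forall x : R, 0 < x -> x < h -> dphi x <= 0) -> phi h <= phi 0.
Proof.
move=> phi_cont; rewrite le_eqVlt => /predU1P[<- //|h0] dphiE dphi_le0.
have [||x /itvP xh E] := MVT h0 (f := phi) (df := dphi).
- by move=> x /itvP xh; apply: dphiE; rewrite xh.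
- exact: continuous_subspaceT.
have : dphi x * (h - 0) <= 0 by rewrite mulr_le0_ge0 ?dphi_le0 ?xh//; lra.
lra.
Qed.

(** Continuity is required on the whole line, so that compositions of [g] with
affine maps need no care at the endpoint [0]; the derivative is prescribed at
interior points only. *)
Definition antiderivative_on_halfline (R : realType) (f g : R -> R) : Prop :=
  continuous g /\ forall x : R, 0 < x -> is_derive x 1 g (f x).

Lemma is_derive_affine_comp (R : realType) (g : R -> R) (c k u d : R) :
  is_derive (c + k * u) 1 g d ->
  is_derive u 1 (fun v => g (c + k * v)) (d * k).
Proof.
move=> dg; apply: (@is_derive1_comp _ g (fun v => c + k * v)).
have -> : (fun v : R => c + k * v) = cst c + k \*: id by [].
have := is_deriveD (is_derive_cst c u 1) (is_deriveZ k (is_derive_id u 1)).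
by rewrite add0r /GRing.scale/= mulr1.
Qed.

Lemma continuous_affine_comp (R : realType) (g : R -> R) (c k : R) :
  continuous g -> continuous (fun v => g (c + k * v)).
Proof.
move=> g_cont v.
apply: (@continuous_comp _ _ _ (fun v => c + k * v) g); last exact: g_cont.
by apply: cvgD; [exact: cvg_cst|apply: cvgMr; exact: cvg_id].
Qed.

(** Midpoint concavity compares [g] at two points that move apart, subadditivity
and monotonicity compare it at two points that move in parallel; [k = -1] and
[k = 1] cover the two situations. *)
Lemma antiderivative_pair_le (R : realType) (f g : R -> R)
    (gf : antiderivative_on_halfline f g) (x y k C h : R) :
  0 <= h ->
  (forall u, 0 < u -> u < h ->
    [/\ 0 < x + u, 0 < y + k * u & f (x + u) - k * f (y + k * u) <= C]) ->
  g (x + h) - g x - (g (y + k * h) - g y) <= h * C.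
Proof.
move=> h0 fC; have [g_cont dg] := gf.
pose phi := fun u : R => g (x + 1 * u) - g (y + k * u) - (0 + C * u).
suff : phi h <= phi 0 by rewrite /phi !mulr0 !addr0 !mul1r; lra.
apply: (@le_of_derive_le0 _ phi
          (fun u => f (x + 1 * u) * 1 - f (y + k * u) * k - 1 * C)) => //.
- move=> u; apply: cvgB; last first.
    exact: (@continuous_affine_comp _ id 0 C (fun=> cvg_id)).
  by apply: cvgB; exact: continuous_affine_comp.
- move=> u u0 uh; have [xu yu _] := fC u u0 uh.
  rewrite -[u in x + u]mul1r in xu.
  have e1 := is_derive_affine_comp (dg _ xu).
  have e2 := is_derive_affine_comp (dg _ yu).
  have e3 := is_derive_affine_comp (is_derive_id (0 + C * u) (1 : R)).
  exact: is_deriveB (is_deriveB e1 e2) e3.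
- by move=> u u0 uh; have [_ _] := fC u u0 uh; rewrite !mul1r; lra.
Qed.

(** The Hermite-Hadamard inequality for [f]: its mean over an interval is at most
its value at the midpoint. *)
Lemma antiderivative_midpoint (R : realType) (f g : R -> R)
    (f_concave : concave_on_halfline f) (gf : antiderivative_on_halfline f g)
    (m h : R) : 0 <= h -> h <= m -> g (m + h) - g (m - h) <= 2 * h * f m.
Proof.
move=> h0 hm.
have : g (m + h) - g m - (g (m + -1 * h) - g m) <= h * (2 * f m); last first.
  by rewrite mulN1r; lra.
apply: (antiderivative_pair_le gf) => // u u0 uh; split; [lra|lra|].
have mp : 0 <= m + u by lra.
have mn : 0 <= m - u by lra.
have half01 : 0 <= (1 / 2 : R) <= 1 by lra.
have := f_concave _ _ _ mp mn half01.
have -> : 1 / 2 * (m + u) + (1 - 1 / 2) * (m - u) = m by field.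
rewrite !mulN1r; lra.
Qed.

(** The bound [M] plays the role of [max t ((x + y) / 2)]; keeping it as a
parameter makes the product [(y - x) * M] available for both values of the
maximum. *)
Lemma antiderivative_increment (R : realType) (f g : R -> R)
    (f_ge0 : forall x, 0 <= x -> 0 <= f x) (f_concave : concave_on_halfline f)
    (gf : antiderivative_on_halfline f g) (x y t M : R) :
  0 <= x -> x <= y -> 0 < t -> t <= M -> (x + y) / 2 <= M ->
  t * (g y - g x) <= (y - x) * M * f t.
Proof.
move=> x0 xy t0 tM mM.
have h0 : 0 <= (y - x) / 2 by lra.
have hm : (y - x) / 2 <= (x + y) / 2 by lra.
have := antiderivative_midpoint f_concave gf h0 hm.
have -> : (x + y) / 2 + (y - x) / 2 = y by field.
have -> : (x + y) / 2 - (y - x) / 2 = x by field.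
have -> : 2 * ((y - x) / 2) = y - x by field.
move=> /(ler_wpM2l (ltW t0)) /le_trans; apply.
rewrite mulrCA -mulrA ler_wpM2l ?subr_ge0//.
apply: le_trans (concave_ge0_ratio f_ge0 f_concave (ltW t0) tM).
by rewrite ler_wpM2l ?(ltW t0)//; apply: concave_ge0_nondecreasing => //; lra.
Qed.

Lemma antiderivative_shift (R : realType) (f g : R -> R) (C : R)
    (gf : antiderivative_on_halfline f g) (x y h : R) :
  0 <= x -> 0 <= y -> 0 <= h ->
  (forall u, 0 < u -> f (x + u) <= f (y + u) + C) ->
  g (x + h) - g x - (g (y + h) - g y) <= h * C.
Proof.
move=> x0 y0 h0 fC; rewrite -[h in y + h]mul1r.
apply: (antiderivative_pair_le gf) => // u u0 uh; rewrite !mul1r.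
by have := fC u u0; split; lra.
Qed.

(** Subadditivity and monotonicity give [f (x + u) <= f (y + u) + f t]. *)
Lemma antiderivative_shift_le (R : realType) (f g : R -> R)
    (f_ge0 : forall x, 0 <= x -> 0 <= f x) (f_concave : concave_on_halfline f)
    (gf : antiderivative_on_halfline f g) (x y t h : R) :
  0 <= x -> 0 <= y -> 0 <= h -> 0 <= t -> x <= y + t ->
  g (x + h) - g x - (g (y + h) - g y) <= h * f t.
Proof.
move=> x0 y0 h0 t0 xyt; apply: (antiderivative_shift gf) => // u u0.
apply: (@le_trans _ _ (f (y + u + t))).
  by apply: concave_ge0_nondecreasing => //; lra.
by apply: concave_ge0_subadditive => //; lra.
Qed.

Lemma antiderivative_convex (R : realType) (f g : R -> R)
    (f_ge0 : forall x, 0 <= x -> 0 <= f x) (f_concave : concave_on_halfline f)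
    (gf : antiderivative_on_halfline f g) (x y h : R) :
  0 <= x -> 0 <= h -> x <= y ->
  g (x + h) - g x <= g (y + h) - g y.
Proof.
move=> x0 h0 xy; rewrite -subr_le0 -[leRHS](mulr0 h).
apply: (antiderivative_shift gf) => //; first lra.
by move=> u u0; rewrite addr0; apply: concave_ge0_nondecreasing => //; lra.
Qed.

(** * The inequality for four numbers *)

(** Each increment is at most its length times [f t] (at most [s * f t]) or the
difference of squares of its ends times [f t / (2 t)]. When both increments use
the second bound the squares add up to at most [s * f t]; when only one does, the
other difference of squares is nonnegative and can be added, which gives
[s * f t] from each bound. *)
Lemma two_increments_le (R : realType) (f g : R -> R)
    (f_ge0 : forall x, 0 <= x -> 0 <= f x) (f_concave : concave_on_halfline f)
    (gf : antiderivative_on_halfline f g) (x x' y y' s t : R) :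
  0 <= x -> x <= x' -> x' <= x + s -> 0 <= y -> y <= y' -> y' <= y + s ->
  0 < t -> x' ^+ 2 - x ^+ 2 + (y' ^+ 2 - y ^+ 2) <= 2 * s * t ->
  g x' - g x + (g y' - g y) <= 2 * s * f t.
Proof.
move=> x0 xx' xs y0 yy' ys t0 quad.
have F0 := f_ge0 _ (ltW t0).
pose M := Num.max t ((x + x') / 2); pose N := Num.max t ((y + y') / 2).
have [tM xM] : t <= M /\ (x + x') / 2 <= M.
  by rewrite /M !le_max !lexx orbT.
have [tN yN] : t <= N /\ (y + y') / 2 <= N.
  by rewrite /N !le_max !lexx orbT.
have Hx := antiderivative_increment f_ge0 f_concave gf x0 xx' t0 tM xM.
have Hy := antiderivative_increment f_ge0 f_concave gf y0 yy' t0 tN yN.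
rewrite -(ler_pM2l t0) mulrDr.
suff : ((x' - x) * M + (y' - y) * N) * f t <= (2 * s * t) * f t by lra.
apply: ler_wpM2r => //.
have lx : (x' - x) * t <= s * t by apply: ler_wpM2r; lra.
have ly : (y' - y) * t <= s * t by apply: ler_wpM2r; lra.
have px : 0 <= (x' - x) * (x + x') by apply: mulr_ge0; lra.
have py : 0 <= (y' - y) * (y + y') by apply: mulr_ge0; lra.
have qx : 0 <= (x' - x) * t by apply: mulr_ge0; lra.
have qy : 0 <= (y' - y) * t by apply: mulr_ge0; lra.
by rewrite /M /N; case: (leP t ((x + x') / 2)) => _;
   case: (leP t ((y + y') / 2)) => _; lra.
Qed.

(** The increment over [e, b] is subtracted, and compensates part of the one
over [c, a]. If [e, b] is the longer interval, its initial part as long as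
[c, a] compensates up to [(a - c) * f t]. Otherwise the part of [c, a] to compare
with [e, b] depends on the relative position of the two intervals. Cutting off the right end, of length [b - e], leaves
[c, a - (b - e)]. If [a <= b] the cut piece lies to the left of [e, b] and is
fully compensated, as [g] is convex. If [e < c] it is compensated up to [(b - e) * f t], while
the midpoint of [c, a] is right of that of [e, b], which leaves room in the
quadratic bound. In the remaining case [e, b] is inside [c, a]. *)
Lemma opposite_increments_le (R : realType) (f g : R -> R)
    (f_ge0 : forall x, 0 <= x -> 0 <= f x) (f_concave : concave_on_halfline f)
    (gf : antiderivative_on_halfline f g) (a b c e s t : R) :
  (forall x y, 0 <= x -> x <= y -> g x <= g y) ->
  0 <= c -> c <= a -> a <= c + s -> 0 <= e -> e <= b -> b <= e + s ->
  0 < t -> a <= b + t -> b <= a + t -> c <= e + t -> e <= c + t ->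
  a ^+ 2 - c ^+ 2 - b ^+ 2 + e ^+ 2 <= 2 * s * t ->
  g a - g c - g b + g e <= 2 * s * f t.
Proof.
move=> g_mono c0 ca acs e0 eb bes t0 abt bat cet ect quad.
have F0 := f_ge0 _ (ltW t0).
have t0' := ltW t0.
have [uw|wu] := leP (a - c) (b - e).
  have u0 : 0 <= a - c by lra.
  have := antiderivative_shift_le f_ge0 f_concave gf c0 e0 u0 t0' cet.
  have : g (e + (a - c)) <= g b by apply: g_mono; lra.
  rewrite [c + _]addrC subrK.
  have : (a - c) * f t <= 2 * s * f t by apply: ler_wpM2r => //; lra.
  lra.
have w0 : 0 <= b - e by lra.
have wu0 : 0 <= (b - e) * (a - c - (b - e)) by apply: mulr_ge0; lra.
have wst : 0 <= (s - (b - e)) * t by apply: mulr_ge0; lra.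
have ust : 0 <= (s - (a - c)) * t by apply: mulr_ge0; lra.
have wt0 : 0 <= (b - e) * t by apply: mulr_ge0; lra.
pose M := Num.max t ((c + (a - (b - e))) / 2).
have [tM cM] : t <= M /\ (c + (a - (b - e))) / 2 <= M.
  by rewrite /M !le_max !lexx orbT.
have caw : c <= a - (b - e) by lra.
have rest := antiderivative_increment f_ge0 f_concave gf c0 caw t0 tM cM.
have [ab|ba] := leP a b.
  have aw0 : 0 <= a - (b - e) by lra.
  have awe : a - (b - e) <= e by lra.
  have := antiderivative_convex f_ge0 f_concave gf aw0 w0 awe.
  rewrite subrK [e + _]addrC subrK => shift.
  suff : t * (g (a - (b - e)) - g c) <= t * (2 * s * f t).
    by rewrite ler_pM2l//; lra.
  suff : (a - (b - e) - c) * M * f t <= (2 * s * t) * f t by lra.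
  apply: ler_wpM2r => //.
  (* The midpoints of [c, a] and [e, b] are at distance at most [t]. *)
  have wt : 0 <= (b - e) * (a + c + 2 * t - (b + e)) by apply: mulr_ge0; lra.
  rewrite /M; case: (leP t ((c + (a - (b - e))) / 2)) => _; lra.
have [ce|ec] := leP c e.
  have : g e - g c + (g a - g b) <= 2 * s * f t.
    by apply: (two_increments_le f_ge0 f_concave gf) => //; lra.
  lra.
have aw0 : 0 <= a - (b - e) by lra.
have awe : a - (b - e) <= e + t by lra.
have := antiderivative_shift_le f_ge0 f_concave gf aw0 e0 w0 t0' awe.
rewrite subrK [e + _]addrC subrK => shift.
suff : t * (g (a - (b - e)) - g c) <= t * (2 * s * f t - (b - e) * f t).
  by rewrite ler_pM2l//; lra.
suff : (a - (b - e) - c) * M * f t <= ((2 * s - (b - e)) * t) * f t by lra.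
apply: ler_wpM2r => //.
(* The midpoint of [e, b] is to the left of that of [c, a]. *)
have wt : 0 <= (b - e) * (a + c - (b + e)) by apply: mulr_ge0; lra.
rewrite /M; case: (leP t ((c + (a - (b - e))) / 2)) => _; lra.
Qed.

(** Exchanging [a] with [e] and [b] with [c] preserves every assumption and the
conclusion, so that [a - c] and [e - b] of opposite signs may be taken in either
order. *)
Lemma quadruple_le (R : realType) (f g : R -> R)
    (f_ge0 : forall x, 0 <= x -> 0 <= f x) (f_concave : concave_on_halfline f)
    (gf : antiderivative_on_halfline f g) (a b c e s t : R) :
  (forall x y, 0 <= x -> x <= y -> g x <= g y) ->
  0 <= a -> 0 <= b -> 0 <= c -> 0 <= e -> 0 <= s -> 0 < t ->
  a <= c + s -> c <= a + s -> b <= e + s -> e <= b + s ->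
  a <= b + t -> b <= a + t -> c <= e + t -> e <= c + t ->
  a ^+ 2 - c ^+ 2 - b ^+ 2 + e ^+ 2 <= 2 * s * t ->
  g a - g c - g b + g e <= 2 * s * f t.
Proof.
move=> g_mono a0 b0 c0 e0 s0 t0 acs cas bes ebs abt bat cet ect quad.
have [ca|/ltW ac] := leP c a; have [eb|/ltW be] := leP e b.
- exact: (opposite_increments_le f_ge0 f_concave gf).
- have : g a - g c + (g e - g b) <= 2 * s * f t.
    by apply: (two_increments_le f_ge0 f_concave gf) => //; lra.
  lra.
- have gac := g_mono _ _ a0 ac; have geb := g_mono _ _ e0 eb.
  have : 0 <= 2 * s * f t by rewrite !mulr_ge0 ?f_ge0// ltW.
  lra.
- have : g e - g b - g c + g a <= 2 * s * f t.
    by apply: (opposite_increments_le f_ge0 f_concave gf) => //; lra.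
  lra.
Qed.

(** * From the half-line to the line *)

Lemma differentiable_on_halfline_cvg0 (R : realType) (tau : R -> R) :
  differentiable_on_halfline tau -> tau h @[h --> 0^'+] --> tau 0.
Proof.
move=> [tau0 _].
have lim0 : h * right_quotient tau 0 h + tau 0 @[h --> (0 : R)^'+] -->
    0 * lim (right_quotient tau 0 h @[h --> 0^'+]) + tau 0.
  apply: cvgD; last exact: cvg_cst.
  apply: cvgM => //.
  by apply: cvg_at_right_filter; exact: cvg_id.
rewrite mul0r add0r in lim0.
apply: cvg_trans lim0; apply: near_eq_cvg.
near=> h.
have h0 : h != 0 by rewrite gt_eqF//; near: h; exact: nbhs_right_gt.
by rewrite /right_quotient addr0 mulVKf// subrK.
Unshelve. all: end_near. Qed.

Lemma halfline_derive_ge0 (R : realType) (tau : R -> R) :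
  differentiable_on_halfline tau ->
  {in `[0, +oo[ &, {homo tau : s t / s <= t}} ->
  forall x, 0 <= x -> 0 <= halfline_derive tau x.
Proof.
move=> [tau0 dtau] tau_mono x x0; rewrite /halfline_derive.
case: eqVneq => [_|xN0].
  apply: limr_ge => //; near=> h.
  have h0 : 0 < h by near: h; exact: nbhs_right_gt.
  rewrite /right_quotient mulr_ge0 ?invr_ge0 ?(ltW h0)// subr_ge0.
  by apply: tau_mono; rewrite ?in_itv/= ?addr0 ?lexx ?(ltW h0).
have xgt0 : 0 < x by rewrite lt0r xN0.
apply: limr_ge.
  have := dtau _ xgt0; rewrite /derivable.
  by under eq_fun do rewrite [_%:A]mulr1.
near=> h.
have h0 : h != 0 by near: h; exact: nbhs_dnbhs_neq.
have hx0 : 0 <= h + x.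
  suff : `|h| < x by rewrite ltr_norml; lra.
  by near: h; exact: dnbhs0_lt.
rewrite /GRing.scale/=; move: h0; rewrite neq_lt => /orP[h0|h0].
- rewrite nmulr_rge0 ?invr_lt0// subr_le0.
  by apply: tau_mono; rewrite ?in_itv/= ?x0 ?hx0//; lra.
- rewrite pmulr_rge0 ?invr_gt0// subr_ge0.
  by apply: tau_mono; rewrite ?in_itv/= ?x0 ?hx0//; lra.
Unshelve. all: end_near. Qed.

(** The even extension is continuous at [0] because [tau] is right-continuous
there; its values at nonnegative arguments are those of [tau]. *)
Lemma antiderivative_even_extension (R : realType) (tau : R -> R) :
  differentiable_on_halfline tau ->
  antiderivative_on_halfline (halfline_derive tau) (fun x => tau `|x|).
Proof.
move=> tau_diff; have [_ dtau] := tau_diff.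
have dg (x : R) : 0 < x ->
    is_derive x 1 (fun x => tau `|x|) (halfline_derive tau x).
  move=> x0; rewrite /halfline_derive gt_eqF// derive1E.
  apply: (@near_eq_is_derive _ _ _ tau).
    near=> y; rewrite gtr0_norm//; near: y; exact: lt_nbhsr.
  by apply: derivableP; exact: dtau.
split=> // x; have [x0|x0|->] := ltgtP x 0.
- have -> : (fun x : R => tau `|x|) = (fun x : R => tau `|x|) \o -%R.
    by apply/funext => y /=; rewrite normrN.
  apply: continuous_comp; first exact: opp_continuous.
  have xN0 : 0 < - x by lra.
  apply: differentiable_continuous; rewrite -derivable1_diffP.
  by have [] := dg _ xN0.
- apply: differentiable_continuous; rewrite -derivable1_diffP.
  by have [] := dg _ x0.
- apply/cvgrPdist_le => e e0.
  have /cvgrPdist_le/(_ e e0) [d d0 near0] := differentiable_on_halfline_cvg0 tau_diff.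
  exists d => //= y; rewrite /ball/= sub0r normrN => yd.
  have [->|y0] := eqVneq y 0; first by rewrite subrr normr0 ltW.
  rewrite normr0; apply: near0; last by rewrite normr_gt0.
  by rewrite /ball/= sub0r normrN normr_id.
Unshelve. all: end_near. Qed.

Lemma concave_function_halfline (R : realType) (f : R -> R) :
  concave_function (`[0, +oo[ : set R) f -> concave_on_halfline f.
Proof.
move=> f_concave x y l x0 y0 /andP[l0 l1].
apply: (f_concave (Itv01 l0 l1)); by rewrite inE/= in_itv/= ?x0 ?y0.
Qed.

Theorem theorem1 (R : realType) (Q : metricType R) (y z q p : Q)
    (hquad : mdist y q ^+ 2 - mdist y p ^+ 2 - mdist z q ^+ 2 + mdist z p ^+ 2
             <= 2 * mdist q p * mdist y z)
    (tau : R -> R)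
    (tau_diff : differentiable_on_halfline tau)
    (tau_nondecreasing : {in `[0, +oo[ &, {homo tau : s t / s <= t}})
    (tau_convex : convex_function (`[0, +oo[ : set R) tau)
    (dtau_concave : concave_function (`[0, +oo[ : set R) (halfline_derive tau)) :
  tau (mdist y q) - tau (mdist y p) - tau (mdist z q) + tau (mdist z p)
    <= 2 * mdist q p * halfline_derive tau (mdist y z).
Proof.
have f_ge0 := halfline_derive_ge0 tau_diff tau_nondecreasing.
(* When [y = z] the left-hand side is [0], and the bounds by [f t], which
   rescale by [t], are not available. *)
have [yz|yz] := eqVneq y z.
  have := f_ge0 _ (mdist_ge0 y z).
  move=> /(mulr_ge0 (mulr_ge0 (ler0n R 2) (mdist_ge0 q p))).
  by rewrite yz; lra.
have f_concave := concave_function_halfline dtau_concave.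
have gf := antiderivative_even_extension tau_diff.
have g_mono (u v : R) : 0 <= u -> u <= v -> tau `|u| <= tau `|v|.
  move=> u0 uv; have v0 := le_trans u0 uv; rewrite !ger0_norm//.
  by apply: tau_nondecreasing; rewrite ?in_itv/= ?u0 ?v0.
have tri (u v w : Q) : mdist u v <= mdist w v + mdist u w.
  by rewrite addrC metric_triangle.
have := @quadruple_le _ _ _ f_ge0 f_concave gf (mdist y q) (mdist z q)
  (mdist y p) (mdist z p) (mdist q p) (mdist y z) g_mono.
rewrite !(ger0_norm (mdist_ge0 _ _)); apply; rewrite ?mdist_ge0 ?mdist_gt0//.
- by rewrite (metric_sym q p) metric_triangle.
- exact: metric_triangle.
- by rewrite (metric_sym q p) metric_triangle.
- exact: metric_triangle.
- by rewrite (metric_sym y z); exact: tri.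
- by rewrite (metric_sym y z); exact: tri.
Qed.
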